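(* Let $X'\subset X$ and $g\in\mathcal{G}$. Consider the following statements: (U) Problem $(\mathcal{P}')$ has a unique solution; (C) $\{(\partial^\circ g)^{-1}(y)\}_{y\in\mathrm{ldom}(B^\circ g)}$ is a covering of $X'\cap\mathrm{udom}(g)$; (M) $\{(\partial^\circ g)^{-1}(y)\}_{y\in\mathrm{ldom}(B^\circ g)}$ is a topologically minimal covering of $X'\cap\mathrm{udom}(g)$. Then (U) and (C) together imply (M). The implication (U)$\Rightarrow$(M) holds if [(A5) or (A5$'$)] and [(A6) or (A6$'$)] are satisfied, where (A5): $Y$ is discrete; (A5$'$): $b$ is continuous in the second variable, and $B^\circ g(y)>-\infty$ for all $y\in Y$; (A6): $B^\circ g\in\mathcal{F}_c$; (A6$'$): $b$ is coercive and $X'\subset\mathrm{idom}(g)\cup g^{-1}(-\infty)$. The equivalence (U)$\Leftrightarrow$(M) holds if we assume in addition (to [(A5) or (A5$'$)] and [(A6) or (A6$'$)]) that $B^\circ g$ is quasi-continuous on its domain. In particular, this equivalence holds when $Y$ is finite.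
   Context: Setting. $\overline{\mathbb{R}}=\mathbb{R}\cup\{\pm\infty\}$ with its usual order and topology. $X,Y$ are nonempty Hausdorff topological spaces, $\mathcal{F}=\mathrm{lsc}(Y,\overline{\mathbb{R}})$ is the set of lower semicontinuous functions $Y\to\overline{\mathbb{R}}$, $\mathcal{G}=\overline{\mathbb{R}}^X$ is the set of all functions $X\to\overline{\mathbb{R}}$, both with the pointwise order. $(B,B^\circ)$, $B:\mathcal{F}\to\mathcal{G}$, $B^\circ:\mathcal{G}\to\mathcal{F}$, is a dual Galois connection: $g\geq Bf\iff f\geq B^\circ g$ for all $f\in\mathcal{F},g\in\mathcal{G}$. Its kernels are the (unique) maps $b:X\times Y\times\overline{\mathbb{R}}\to\overline{\mathbb{R}}$, $b^\circ:Y\times X\times\overline{\mathbb{R}}\to\overline{\mathbb{R}}$ such that for all $(x,y)$, $(b(x,y,\cdot),b^\circ(y,x,\cdot))$ is a dual Galois connection between $\overline{\mathbb{R}}$ and $\overline{\mathbb{R}}$ (i.e. $t\geq b(x,y,s)\iff s\geq b^\circ(y,x,t)$), $b^\circ(\cdot,x,t)\in\mathcal{F}$ for all $x,t$, and $Bf(x)=\sup_{y\in Y}b(x,y,f(y))$, $B^\circ g(y)=\sup_{x\in X}b^\circ(y,x,g(x))$. Standing assumptions. There is a subset $\mathcal{S}\subset X\times Y$ such that: (A1) $\mathcal{S}_x=\{y\in Y\mid(x,y)\in\mathcal{S}\}\neq\emptyset$ for all $x\in X$; (A2) $\mathcal{S}^y=\{x\in X\mid(x,y)\in\mathcal{S}\}\neq\emptyset$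 for all $y\in Y$; (A3) $b(x,y,\cdot)$ is a bijection $\overline{\mathbb{R}}\to\overline{\mathbb{R}}$ for all $(x,y)\in\mathcal{S}$; (A4) $b(x,y,\cdot)\equiv-\infty$ for $(x,y)\in(X\times Y)\setminus\mathcal{S}$. Problem $(\mathcal{P}')$ (for given $g\in\mathcal{G}$, $X'\subset X$): find $f\in\mathcal{F}$ such that $Bf\leq g$ and $Bf(x)=g(x)$ for all $x\in X'$. Domains. For $h:Z\to\overline{\mathbb{R}}$, $Z$ a topological space: $\mathrm{ldom}(h)=\{z\mid h(z)<+\infty\}$, $\mathrm{udom}(h)=\{z\mid h(z)>-\infty\}$, $\mathrm{dom}(h)=\mathrm{ldom}(h)\cap\mathrm{udom}(h)$, $\mathrm{idom}(h)=\{z\in\mathrm{dom}(h)\mid\limsup_{z'\to z}h(z')<+\infty\}$. Subdifferential of $g\in\mathcal{G}$ at $x\in X$: $\partial^\circ g(x)=\{y\in Y\mid(x,y)\in\mathcal{S},\ b^\circ(y,x',g(x'))\leq b^\circ(y,x,g(x))\ \forall x'\in X\}$, and $(\partial^\circ g)^{-1}(y)=\{x\in X\mid y\in\partial^\circ g(x)\}$. Coverings. For a map $F$ from a set $Z$ to the set of subsets of $W$, $Z'\subset Z$, $W'\subset W$: $\{F(z)\}_{z\in Z'}$ is a covering of $W'$ if $\bigcup_{z\in Z'}F(z)\supset W'$. When $Z$ is a topological space, $y\in Z'$ is topologically essential with respect to this covering if for all open neighbourhoods $U$ of $y$ in $Z'$ (induced topology) there is $w\in W'$ with $w\notin\bigcup_{z\in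 Z'\setminus U}F(z)$. The covering is topologically minimal if all elements of $Z'$ are topologically essential. $b$ is continuous in the second variable if $b(x,\cdot,\alpha)$ is continuous for all $x\in X$, $\alpha\in\mathbb{R}$. $b$ is coercive if for all $x\in X$, all neighbourhoods $V$ of $x$ in $X$ and all $\alpha\in\mathbb{R}$, the function $b^\alpha_{x,V}(y)=\sup_{z\in V}b(z,y,b^\circ(y,x,\alpha))$ is such that $\{y\in Y\mid b^\alpha_{x,V}(y)\leq\beta\}$ is relatively compact for all $\beta\in\mathbb{R}$. $\mathcal{F}_c$ is the set of $f\in\mathcal{F}$ such that for all $x\in X$ and $\beta\in\mathbb{R}$, $\{y\in Y\mid b(x,y,f(y))\geq\beta\}$ is relatively compact. A map $h:Z\to W$ between topological spaces is quasi-continuous if for every open $G\subset W$, $h^{-1}(G)$ is included in the closure of its interior. A function $h:Z\to\overline{\mathbb{R}}$ is quasi-continuous on its domain if its restriction to $\mathrm{dom}(h)$, with the induced topology, is quasi-continuous. *)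

(* Defs.v *)
From HB Require Import structures.
From mathcomp Require Import all_boot all_order all_algebra.
From mathcomp Require Import all_classical all_reals all_analysis.
Set Implicit Arguments.
Unset Strict Implicit.
Unset Printing Implicit Defensive.

Import Order.TTheory GRing.Theory Num.Theory.
Import numFieldTopology.Exports numFieldNormedType.Exports.

Local Open Scope classical_set_scope.
Local Open Scope ring_scope.
Local Open Scope ereal_scope.

Record lscfun (R : realType) (Y : topologicalType) := LscFun {
  lscfun_val :> Y -> \bar R ;
  lscfunP : lower_semicontinuous lscfun_val }.

Definition le_pointwise (R : realType) (Z : Type) (h k : Z -> \bar R) : Prop :=
  forall z, h z <= k z.

(* The connection is antitone: u >= A t <-> t >= A° u. *)
Definition dual_galois (T U : Type) (leT : T -> T -> Prop) (leU : U -> U -> Prop)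
    (A : T -> U) (Ao : U -> T) : Prop :=
  forall t u, leU (A t) u <-> leT (Ao u) t.

Section connection.
Context {R : realType} {X Y : topologicalType}.

Definition dual_galois_fun (B : lscfun R Y -> X -> \bar R)
    (Bo : (X -> \bar R) -> lscfun R Y) : Prop :=
  dual_galois (fun f f' : lscfun R Y => le_pointwise f f')
              (fun g g' : X -> \bar R => le_pointwise g g') B Bo.

Definition dual_galois_ereal (phi psi : \bar R -> \bar R) : Prop :=
  dual_galois (fun s s' : \bar R => s <= s') (fun t t' : \bar R => t <= t') phi psi.

Record kernels (B : lscfun R Y -> X -> \bar R) (Bo : (X -> \bar R) -> lscfun R Y)
    (b : X -> Y -> \bar R -> \bar R) (bo : Y -> X -> \bar R -> \bar R) : Prop := {
  kernels_galois : forall x y, dual_galois_ereal (b x y) (bo y x) ;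
  kernels_lsc : forall x t, lower_semicontinuous (fun y => bo y x t) ;
  kernels_sup : forall (f : lscfun R Y) x,
    B f x = ereal_sup [set b x y (f y) | y in [set: Y]] ;
  kernels_supo : forall (g : X -> \bar R) y,
    Bo g y = ereal_sup [set bo y x (g x) | x in [set: X]] }.

Definition solution (B : lscfun R Y -> X -> \bar R) (X' : set X) (g : X -> \bar R)
    (f : lscfun R Y) : Prop :=
  le_pointwise (B f) g /\ (forall x, X' x -> B f x = g x).

Definition subdiff (S : set (X * Y)) (bo : Y -> X -> \bar R -> \bar R)
    (g : X -> \bar R) (x : X) : set Y :=
  [set y | S (x, y) /\ forall x', bo y x' (g x') <= bo y x (g x)].

Definition subdiff_inv (S : set (X * Y)) (bo : Y -> X -> \bar R -> \bar R)
    (g : X -> \bar R) (y : Y) : set X :=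
  [set x | subdiff S bo g x y].

Definition continuous_second (b : X -> Y -> \bar R -> \bar R) : Prop :=
  forall (x : X) (a : R), continuous (fun y => b x y a%:E).

Definition coercive (b : X -> Y -> \bar R -> \bar R)
    (bo : Y -> X -> \bar R -> \bar R) : Prop :=
  forall (x : X) (V : set X) (a : R), nbhs x V ->
  forall beta : R,
    precompact [set y | ereal_sup [set b z y (bo y x a%:E) | z in V] <= beta%:E].

Definition in_Fc (b : X -> Y -> \bar R -> \bar R) (f : lscfun R Y) : Prop :=
  forall (x : X) (beta : R), precompact [set y | beta%:E <= b x y (f y)].

End connection.

Section domains.
Context {R : realType} {Z : topologicalType}.
Implicit Type h : Z -> \bar R.

Definition ldom h : set Z := [set z | h z < +oo].

Definition udom h : set Z := [set z | -oo < h z].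

Definition edom h : set Z := ldom h `&` udom h.

(* The limsup is over all z' near z, z included; since h z < +oo on edom h, excluding
   z would give the same set. *)
Definition idom h : set Z := [set z | edom h z /\ limf_esup h (nbhs z) < +oo].

End domains.

Section coverings.
Context {Z : topologicalType} {W : Type}.
Variables (F : Z -> set W) (Z' : set Z) (W' : set W).

Definition is_covering : Prop := W' `<=` \bigcup_(z in Z') F z.

(* The open sets of the topology induced on Z' are the V `&` Z' with V open in Z. *)
Definition topologically_essential (y : Z) : Prop :=
  forall V : set Z, open V -> (V `&` Z') y ->
  exists2 w, W' w & ~ (\bigcup_(z in Z' `\` (V `&` Z')) F z) w.

Definition topologically_minimal_covering : Prop :=
  is_covering /\ forall y, Z' y -> topologically_essential y.

End coverings.

Definition quasi_continuous (Z W : topologicalType) (h : Z -> W) : Prop :=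
  forall G : set W, open G -> h @^-1` G `<=` closure (h @^-1` G)°.

(* The set edom h, seen as a type, carries the induced topology. *)
Definition quasi_continuous_on_domain (R : realType) (Z : topologicalType)
    (h : Z -> \bar R) : Prop :=
  @quasi_continuous (set_type (edom h)) (\bar R) (sigL (edom h) h).

(* Main.v *)
(** The least candidate solution is [Bo g], and [y] is a subgradient of [g] at [x]
    exactly when [b x y (Bo g y) = g x].  A non-essential point of the covering
    yields a second solution by raising [Bo g] to [+oo] on an open set.
    Conversely, upper semicontinuity and compactness of superlevel sets make the
    supremum defining [B f x = g x] attained; at a maximizer [y], a solution [f]
    agrees with [Bo g] and [y] is a subgradient.  If [f <> Bo g],
    quasi-continuity provides an open set meeting the domain on which
    [Bo g < f], so its points could be dropped from the covering. *)

Require Import Defs.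
From HB Require Import structures.
From mathcomp Require Import all_boot all_order all_algebra.
From mathcomp Require Import all_classical all_reals all_analysis.
Set Implicit Arguments.
Unset Strict Implicit.
Unset Printing Implicit Defensive.

Import Order.TTheory GRing.Theory Num.Theory.

Local Open Scope classical_set_scope.
Local Open Scope ring_scope.
Local Open Scope ereal_scope.

(** * Extended reals, attained suprema and semicontinuity *)

Lemma ereal_fin_between (R : realType) (x y : \bar R) :
  x < y -> exists r : R, x < r%:E < y.
Proof.
case: x y => [x||] [y||] //= xy.
- by exists ((x + y) / 2)%R; rewrite !lte_fin !midf_lt.
- by exists (x + 1)%R; rewrite lte_fin ltrDl ltr01 ltry.
- by exists (y - 1)%R; rewrite lte_fin gtrDl ltrN10 ltNyr.
- by exists 0%R; rewrite ltry ltNyr.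
Qed.

(** The superlevel sets at real levels below the supremum form a filter base of nonempty sets.
    Compactness of one of them gives a cluster point, and closedness puts it in all of them. *)
Lemma ereal_sup_attained (R : realType) (T : topologicalType) (h : T -> \bar R) :
  -oo < ereal_sup (range h) ->
  (forall beta : R, closed [set y | beta%:E <= h y]) ->
  (forall beta : R, precompact [set y | beta%:E <= h y]) ->
  exists y, h y = ereal_sup (range h).
Proof.
set s := ereal_sup _ => sNy hcl hpc.
have [r0 /andP[_ r0s]] := ereal_fin_between sNy.
pose L (r : R) := [set y | r%:E <= h y].
pose D := [set r : R | r%:E < s].
have FF : Filter (filter_from D L).
  apply: filter_from_filter; first by exists r0.
  move=> i j Di Dj; have [ij|ji] := leP i j.
    by exists j => // y Lj; split => //; apply: le_trans Lj; rewrite lee_fin.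
  by exists i => // y Li; split => //; apply: le_trans Li; rewrite lee_fin ltW.
have PF : ProperFilter (filter_from D L).
  by apply: filter_from_proper => r /ereal_sup_gt[_ [y _ <-] /ltW]; exists y.
have : compact (L r0) by rewrite -precompact_closed; [exact: hpc|exact: hcl].
move=> /(_ _ PF) [|y [_ yF]]; first by exists r0.
exists y; apply/eqP; rewrite eq_le; apply/andP; split.
  by apply: ereal_sup_ubound; exists y.
rewrite leNgt; apply/negP => /ereal_fin_between[r /andP[hr rs]].
suff /(le_lt_trans)/(_ hr) : r%:E <= h y by rewrite ltxx.
apply: (hcl r) => V /(yF (L r)); apply; by exists r.
Qed.

Lemma finite_hausdorff_discrete (T : topologicalType) :
  hausdorff_space T -> finite_set [set: T] -> forall D : set T, open D.
Proof.
move=> /hausdorff_accessible/accessible_finite_set_closed hT finT D.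
by rewrite -closedC; apply: hT; exact: (sub_finite_set (@subsetT _ _) finT).
Qed.

Lemma lscfun_ext (R : realType) (Y : topologicalType) (f f' : lscfun R Y) :
  f =1 f' -> f = f'.
Proof.
case: f f' => [f fP] [f' f'P] /= /funext ff'; subst f'.
by rewrite (Prop_irrelevance fP f'P).
Qed.

(** Used to build a competing solution: strict superlevel sets only gain the open set [V]. *)
Lemma lsc_oo_on (R : realType) (Y : topologicalType) (V : set Y) (f : Y -> \bar R) :
  open V -> lower_semicontinuous f ->
  lower_semicontinuous (fun y => if y \in V then +oo else f y).
Proof.
move=> oV /lower_semicontinuousP fl; apply/lower_semicontinuousP => a.
rewrite (_ : [set _ | _] = V `|` [set y | a%:E < f y]); first exact: openU.
apply/seteqP; split => y /=.
  by case: ifPn => [/set_mem Vy _|_ ?]; [left|right].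
by case: ifPn => [_ _|/negP nV [/mem_set|]] //; exact: ltry.
Qed.

(** * Antitone Galois connections on the extended reals *)

Section dual_galois_ereal.
Context {R : realType} {phi psi : \bar R -> \bar R}.
Hypothesis phipsi : dual_galois_ereal phi psi.

Lemma dual_galois_anti s s' : s <= s' -> phi s' <= phi s.
Proof. by move=> ss'; apply/phipsi; apply: le_trans ss'; exact/phipsi. Qed.

Lemma dual_galois_y : phi +oo = -oo.
Proof. by apply/eqP; rewrite -leeNy_eq; apply/phipsi; exact: leey. Qed.

(** Every such connection satisfies [phi (psi (phi s)) = phi s]; injectivity removes the outer
    [phi]. *)
Lemma dual_galois_cancel : bijective phi -> cancel phi psi.
Proof.
move=> /bij_inj phi_inj s; apply: phi_inj; apply/eqP; rewrite eq_le.
apply/andP; split; first exact/phipsi.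
by apply: dual_galois_anti; exact/phipsi.
Qed.

Lemma dual_galois_cancelV : bijective phi -> cancel psi phi.
Proof. by move=> bij; exact/(bij_can_sym bij)/dual_galois_cancel. Qed.

(** A form of left continuity: bijectivity gives [psi t < s], and any real strictly between the two
    works. *)
Lemma dual_galois_lt_fin s t : bijective phi -> phi s < t ->
  exists2 r : R, r%:E < s & phi r%:E < t.
Proof.
move=> bij st.
have : psi t < s.
  rewrite lt_neqAle; apply/andP; split; last exact/phipsi/ltW.
  by apply: contraTneq st => <-; rewrite dual_galois_cancelV// ltxx.
move=> /ereal_fin_between[r /andP[tr rs]]; exists r => //.
rewrite lt_neqAle; apply/andP; split; last exact/phipsi/ltW.
by apply: contraTneq tr => <-; rewrite dual_galois_cancel// ltxx.
Qed.

End dual_galois_ereal.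

(** * Subgradients, essential points and solutions *)

Section solutions.
Context {R : realType} {X Y : topologicalType}.
Context {B : lscfun R Y -> X -> \bar R} {Bo : (X -> \bar R) -> lscfun R Y}.
Context {b : X -> Y -> \bar R -> \bar R} {bo : Y -> X -> \bar R -> \bar R}.
Context {S : set (X * Y)}.
Hypothesis galoisB : dual_galois_fun B Bo.
Hypothesis kernelsB : kernels B Bo b bo.
Hypothesis A3 : forall x y, S (x, y) -> bijective (b x y).
Hypothesis A4 : forall x y, ~ S (x, y) -> forall s, b x y s = -oo.
Implicit Types (g : X -> \bar R) (f : lscfun R Y).

Let gal x y := kernels_galois kernelsB x y.

Lemma kernel_le_B f x y : b x y (f y) <= B f x.
Proof. by rewrite (kernels_sup kernelsB); apply: ereal_sup_ubound; exists y. Qed.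

Lemma kernel_gtNy x y s : -oo < b x y s -> S (x, y) /\ s < +oo.
Proof.
move=> bs; split; first by apply: contrapT => nS; rewrite A4// in bs.
by rewrite ltey; apply: contraTneq bs => ->; rewrite (dual_galois_y (gal x y)).
Qed.

Lemma B_Bo_le g : le_pointwise (B (Bo g)) g.
Proof. by apply/galoisB => y. Qed.

(** A subgradient [y] at [x] is one for which the supremum defining [Bo g y] is attained at [x]; on
    [S] the equality [Bo g y = bo y x (g x)] can be inverted. *)
Lemma subdiffP g x y :
  subdiff S bo g x y <-> S (x, y) /\ b x y (Bo g y) = g x.
Proof.
have boE : Bo g y = ereal_sup [set bo y x (g x) | x in [set: X]].
  exact: (kernels_supo kernelsB).
split=> -[Sxy h]; split=> //.
  rewrite -[RHS](dual_galois_cancelV (gal x y) (A3 Sxy)); congr (b x y _).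
  rewrite boE; apply/eqP; rewrite eq_le; apply/andP; split.
    by apply: ge_ereal_sup => _ [x' _ <-].
  by apply: ereal_sup_ubound; exists x.
move=> x'; rewrite -h (dual_galois_cancel (gal x y) (A3 Sxy)) boE.
by apply: ereal_sup_ubound; exists x'.
Qed.

Lemma solution_ge X' g f : solution B X' g f -> le_pointwise (Bo g) f.
Proof. by case=> /galoisB. Qed.

(** Since [Bo g] lies below [f] and the kernels are antitone, [B f <= B (Bo g) <= g]. *)
Lemma solution_Bo X' g f : solution B X' g f -> solution B X' g (Bo g).
Proof.
move=> fsol; split; first exact: B_Bo_le.
move=> x X'x; apply/eqP; rewrite eq_le B_Bo_le -(fsol.2 _ X'x)/=.
rewrite (kernels_sup kernelsB); apply: ge_ereal_sup => _ [y _ <-].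
apply: le_trans (kernel_le_B _ _ y).
by apply: (dual_galois_anti (gal x y)); exact: solution_ge fsol y.
Qed.

(** The Galois connection already gives [B f <= g]. One subgradient where [f] touches [Bo g]
    contributes the value [g x] to the supremum [B f x]. *)
Lemma solution_from_subgradients X' g f : le_pointwise (Bo g) f ->
  (forall x, X' x -> -oo < g x ->
     exists2 y, subdiff S bo g x y & f y = Bo g y) ->
  solution B X' g f.
Proof.
move=> gef fcov; have Bfg : le_pointwise (B f) g by exact/galoisB.
split=> // x X'x; apply/eqP; rewrite eq_le Bfg/= leNgt; apply/negP => lt_g.
have [y /subdiffP[_ bE] fyE] := fcov x X'x (le_lt_trans (leNye _) lt_g).
by move: lt_g; rewrite -bE -fyE ltNge kernel_le_B.
Qed.

Lemma unique_essential X' g :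
  let F := subdiff_inv S bo g in
  (exists! f, solution B X' g f) ->
  forall y, ldom (Bo g) y ->
  topologically_essential F (ldom (Bo g)) (X' `&` udom g) y.
Proof.
move=> F [f0 [f0sol f0uniq]] y0 y0dom V oV [Vy0 _]; apply: contrapT => ness.
pose f1 := LscFun (lsc_oo_on oV (@lscfunP _ _ (Bo g))).
have f1sol : solution B X' g f1.
  apply: solution_from_subgradients => [y|x X'x gx] /=.
    by case: ifP => // _; exact: leey.
  (* Non-essentiality means that the covering survives without [V], so [x] has a subgradient outside
     [V], where [f1] equals [Bo g]. *)
  have : (\bigcup_(z in ldom (Bo g) `\` (V `&` ldom (Bo g))) F z) x.
    by apply: contrapT => nx; apply: ness; exists x.
  move=> [y [ydom nVy] Fy]; exists y => //.
  by case: ifPn => // /set_mem Vy; case: nVy.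
have : f1 y0 = Bo g y0.
  by rewrite -(f0uniq _ f1sol) (f0uniq _ (solution_Bo f0sol)).
move=> /=; rewrite mem_set// => y0oo.
by move: y0dom; rewrite /ldom/= -y0oo ltxx.
Qed.

(** The chain [g x = b x y (f y) <= b x y (Bo g y) <= g x] collapses, and injectivity of the kernel
    on [S] identifies the arguments. *)
Lemma attained_eq_Bo g f x y : le_pointwise (Bo g) f -> -oo < g x ->
  b x y (f y) = g x -> [/\ f y = Bo g y, subdiff S bo g x y & ldom (Bo g) y].
Proof.
move=> gef gx bfg.
have [Sxy _] : S (x, y) /\ f y < +oo by apply: (@kernel_gtNy x); rewrite bfg.
have bE : b x y (Bo g y) = g x.
  apply/eqP; rewrite eq_le (le_trans (kernel_le_B _ _ _) (B_Bo_le _ _))/=.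
  by rewrite -bfg (dual_galois_anti (gal x y)).
split; last by apply: (proj2 (@kernel_gtNy x y _ _)); rewrite bE.
  by apply: (bij_inj (A3 Sxy)); rewrite bfg bE.
by apply/subdiffP.
Qed.

(** In the continuous case the complement is open: a real [r < f y] with [b x y r < beta] keeps both
    inequalities near [y], by lower semicontinuity of [f] and continuity of the kernel. *)
Lemma closed_superlevel g f x (beta : R) :
  (forall D : set Y, open D) \/ (continuous_second b /\ forall y, -oo < Bo g y) ->
  le_pointwise (Bo g) f ->
  closed [set y | beta%:E <= b x y (f y)].
Proof.
move=> [disc _|[bcont Bog_gt] gef]; first by rewrite -openC; exact: disc.
rewrite -openC openE => y /= /negP; rewrite -ltNge => by_lt.
have fy_gt : -oo < f y by exact: lt_le_trans (gef y).
have [r rf br] : exists2 r : R, r%:E < f y & b x y r%:E < beta%:E.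
  have [Sxy|nS] := pselect (S (x, y)).
    exact: (dual_galois_lt_fin (gal x y) (A3 Sxy) by_lt).
  (* Off [S] the kernel is constantly [-oo], so any real below [f y] serves; one exists because
     [-oo < Bo g y <= f y]. *)
  have [r /andP[_ rf]] := ereal_fin_between fy_gt.
  by exists r => //; rewrite A4// ltNyr.
have [V Vy Vf] := @lscfunP _ _ f y r rf.
have : nbhs (b x y r%:E) [set t | t < beta%:E].
  by apply: open_nbhs_nbhs; split => //; exact: open_ereal_lt_ereal.
move=> /(bcont x r y); apply: filterS2 Vy => z /Vf /ltW rz bz.
by apply/negP; rewrite -ltNge (le_lt_trans (dual_galois_anti (gal x z) rz)).
Qed.

Lemma precompact_superlevel X' g x (beta : R) :
  in_Fc b (Bo g) \/
    (coercive b bo /\ X' `<=` idom g `|` g @^-1` [set -oo]) ->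
  X' x -> -oo < g x ->
  precompact [set y | beta%:E <= b x y (Bo g y)].
Proof.
move=> [Fc|[coer X'dom]] X'x gx; first exact: Fc.
have [[_ lim_lt]|/= gNy] := X'dom x X'x; last by rewrite gNy in gx.
(* The finite limsup yields a neighbourhood [V] of [x] on which [g] is at most the real [c];
   coercivity is then used at level [c]. *)
have [_ [V Vx <-] /ereal_fin_between[c /andP[/ltW gc _]]] := ereal_inf_lt lim_lt.
apply: precompact_subset (coer x V beta Vx c) => y /= beta_le.
have [Sxy _] := kernel_gtNy (lt_le_trans (ltNyr beta) beta_le).
(* Bijectivity on [S] lets [beta <= b x y s] be solved for [s], a direction that the Galois
   equivalence alone does not give. *)
have Bo_le : Bo g y <= bo y x beta%:E.
  rewrite -[leLHS](dual_galois_cancel (gal x y) (A3 Sxy)).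
  by apply/(gal x y); rewrite (dual_galois_cancelV (gal x y) (A3 Sxy)).
apply: ge_ereal_sup => _ [z Vz <-].
apply: le_trans (dual_galois_anti (gal z y) Bo_le) _.
apply: le_trans (kernel_le_B _ _ _) _; apply: le_trans (B_Bo_le _ _) _.
by apply: le_trans gc; apply: ereal_sup_ubound; exists z.
Qed.

Lemma solution_subgradient X' g f x :
  (forall D : set Y, open D) \/ (continuous_second b /\ forall y, -oo < Bo g y) ->
  in_Fc b (Bo g) \/
    (coercive b bo /\ X' `<=` idom g `|` g @^-1` [set -oo]) ->
  solution B X' g f -> X' x -> -oo < g x ->
  exists y, [/\ f y = Bo g y, subdiff S bo g x y & ldom (Bo g) y].
Proof.
move=> hc hk fsol X'x gx; have gef := solution_ge fsol.
have BfE : ereal_sup (range (fun y => b x y (f y))) = g x.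
  by rewrite -(fsol.2 _ X'x) (kernels_sup kernelsB).
have [|beta|beta|y] := @ereal_sup_attained R Y (fun y => b x y (f y)).
- by rewrite BfE.
- exact: closed_superlevel hc gef.
(* As [Bo g <= f] and kernels are antitone, superlevel sets for [f] lie inside those for [Bo g]. *)
- apply: precompact_subset (precompact_superlevel beta hk X'x gx) => y /=.
  by move=> /le_trans; apply; exact: (dual_galois_anti (gal x y)).
- by rewrite BfE => /(attained_eq_Bo gef gx); exists y.
Qed.

Lemma unique_minimal_covering X' g :
  (forall D : set Y, open D) \/ (continuous_second b /\ forall y, -oo < Bo g y) ->
  in_Fc b (Bo g) \/
    (coercive b bo /\ X' `<=` idom g `|` g @^-1` [set -oo]) ->
  (exists! f, solution B X' g f) ->
  topologically_minimal_covering (subdiff_inv S bo g) (ldom (Bo g))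
    (X' `&` udom g).
Proof.
move=> hc hk hU; split; last exact: unique_essential.
move: hU => [f [fsol _]] x [X'x gx].
by have [y [_ yg ydom]] := solution_subgradient hc hk fsol X'x gx; exists y.
Qed.

(** The third hypothesis abstracts what discreteness or quasi-continuity supplies. An essential
    point in [V] gives an [x] whose subgradients in [ldom (Bo g)] all lie in [V], where [f] cannot
    touch [Bo g]. *)
Lemma minimal_covering_unique X' g :
  (forall D : set Y, open D) \/ (continuous_second b /\ forall y, -oo < Bo g y) ->
  in_Fc b (Bo g) \/
    (coercive b bo /\ X' `<=` idom g `|` g @^-1` [set -oo]) ->
  (forall f y, Bo g y < f y -> exists V : set Y,
     [/\ open V, V `&` ldom (Bo g) !=set0 &
         forall z, V z -> ldom (Bo g) z -> Bo g z < f z]) ->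
  topologically_minimal_covering (subdiff_inv S bo g) (ldom (Bo g))
    (X' `&` udom g) ->
  exists! f, solution B X' g f.
Proof.
move=> hc hk sep [cov ess]; exists (Bo g); split.
  apply: solution_from_subgradients => [y|x X'x gx]; first exact: lexx.
  by have [y _ yg] := cov x (conj X'x gx); exists y.
move=> f fsol; apply: lscfun_ext => y; apply/eqP.
rewrite eq_le (solution_ge fsol)/= leNgt; apply/negP => /sep.
move=> [V [oV [y1 [Vy1 y1dom]] Vlt]].
have [x [X'x gx] nx] := ess y1 y1dom V oV (conj Vy1 y1dom).
have [z [fz zg zdom]] := solution_subgradient hc hk fsol X'x gx.
apply: nx; exists z => //; split => // -[Vz _].
by have := Vlt z Vz zdom; rewrite fz ltxx.
Qed.

End solutions.

(** * Separation by quasi-continuity, and the equivalence *)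

Lemma quasi_continuous_separation (R : realType) (Y : topologicalType)
    (f0 f : lscfun R Y) (y0 : Y) :
  (forall y, -oo < f0 y) -> quasi_continuous_on_domain f0 -> f0 y0 < f y0 ->
  exists V : set Y, [/\ open V, V `&` ldom f0 !=set0 &
    forall z, V z -> ldom f0 z -> f0 z < f z].
Proof.
move=> f0_gt qc /ereal_fin_between[c /andP[f0c cf]].
have domE z : ldom f0 z -> edom f0 z by split => //; exact: f0_gt.
have y0dom : edom f0 y0 by apply: domE; exact: lt_trans f0c (ltry _).
have oU : open [set y | c%:E < f y].
  exact: (proj1 (lower_semicontinuousP _) (@lscfunP _ _ f) c).
pose u0 : set_type (edom f0) := SigSub (mem_set y0dom).
(* Quasi-continuity puts [y0] in the closure of the relative interior of [f0 < c]; the neighbourhood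
   [c < f] of [y0] therefore meets that interior, and the level [c] separates there. *)
have := qc _ (@open_ereal_lt_ereal R c%:E) u0 f0c.
move=> /(_ (set_val @^-1` [set y | c%:E < f y])) [].
  apply: open_nbhs_nbhs; split => //.
  by exists [set y | c%:E < f y].
move=> u1 [[_ [[W oW <-] Wu1 Wlt]] cfu1].
exists (W `&` [set y | c%:E < f y]); split; first exact: openI.
  by exists (set_val u1); split => //; case: (set_valP u1).
move=> z [Wz cz] /domE zdom; apply: lt_trans cz.
exact: (Wlt (SigSub (mem_set zdom)) Wz).
Qed.

Theorem theorem4p7 (R : realType) (X Y : topologicalType)
    (hausX : hausdorff_space X) (hausY : hausdorff_space Y)
    (X_neq0 : [set: X] !=set0) (Y_neq0 : [set: Y] !=set0)
    (B : lscfun R Y -> X -> \bar R) (Bo : (X -> \bar R) -> lscfun R Y)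
    (galoisB : dual_galois_fun B Bo)
    (b : X -> Y -> \bar R -> \bar R) (bo : Y -> X -> \bar R -> \bar R)
    (kernelsB : kernels B Bo b bo)
    (S : set (X * Y))
    (A1 : forall x, [set y | S (x, y)] !=set0)
    (A2 : forall y, [set x | S (x, y)] !=set0)
    (A3 : forall x y, S (x, y) -> bijective (b x y))
    (A4 : forall x y, ~ S (x, y) -> forall s, b x y s = -oo)
    (X' : set X) (g : X -> \bar R) :
  let U := exists! f : lscfun R Y, solution B X' g f in
  let C := is_covering (subdiff_inv S bo g) (ldom (Bo g)) (X' `&` udom g) in
  let M := topologically_minimal_covering
             (subdiff_inv S bo g) (ldom (Bo g)) (X' `&` udom g) in
  let A5 := forall D : set Y, open D in
  let A5' := continuous_second b /\ (forall y, -oo < Bo g y) in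
  let A6 := in_Fc b (Bo g) in
  let A6' := coercive b bo /\ X' `<=` idom g `|` g @^-1` [set -oo] in
  [/\ U /\ C -> M,
      (A5 \/ A5') /\ (A6 \/ A6') -> U -> M,
      (A5 \/ A5') /\ (A6 \/ A6') -> quasi_continuous_on_domain (Bo g) -> (U <-> M) &
      finite_set [set: Y] -> (U <-> M)].
Proof.
move=> U C M A5 A5' A6 A6'.
have UM : (A5 \/ A5') /\ (A6 \/ A6') -> U -> M.
  by move=> [hc hk]; exact: (unique_minimal_covering galoisB kernelsB A3 A4).
have MU : (A5 \/ A5') /\ (A6 \/ A6') ->
    A5 \/ quasi_continuous_on_domain (Bo g) -> M -> U.
  move=> [hc hk] h; apply: (minimal_covering_unique galoisB kernelsB A3 A4) => //.
  move=> f y ltf.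
  have discrete_sep (disc : A5) : exists V : set Y, [/\ open V,
      V `&` ldom (Bo g) !=set0 &
      forall z, V z -> ldom (Bo g) z -> Bo g z < f z].
    (* The singleton is open, and it meets [ldom (Bo g)] because [Bo g y < f y <= +oo]. *)
    exists [set y]; split; [exact: disc| |by move=> z ->].
    by exists y; split; [|exact: (lt_le_trans ltf (leey _))].
  case: h => [disc|qc]; first exact: discrete_sep.
  case: hc => [disc|[_ Bog_gt]]; first exact: discrete_sep.
  exact: (quasi_continuous_separation Bog_gt qc ltf).
split=> //.
- move=> [hU hC]; split => //.
  exact: (unique_essential galoisB kernelsB A3).
- by move=> h qc; split; [exact: UM|apply: MU => //; right].
(* A finite Hausdorff space is discrete and all its subsets are compact, so [A5] and [A6] both
   hold. *)
- move=> finY; have disc := finite_hausdorff_discrete hausY finY.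
  have h : (A5 \/ A5') /\ (A6 \/ A6').
    split; [by left|left=> x beta; apply: compact_precompact => //].
    by apply: finite_compact; exact: (sub_finite_set (@subsetT _ _) finY).
  by split; [exact: UM|apply: MU => //; left].
Qed.
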